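(* Let $R$ be a Noetherian commutative ring and let $F$ be a countably generated flat $R$-module. Then $F$ is quite flat.
   Context: For a commutative ring $R$, an $R$-module $C$ is called almost cotorsion if $\mathrm{Ext}^1_R(S^{-1}R, C) = 0$ for every (at most) countable multiplicative subset $S \subseteq R$. An $R$-module $F$ is called quite flat if $\mathrm{Ext}^1_R(F, C) = 0$ for every almost cotorsion $R$-module $C$. (Equivalently, the quite flat modules are the direct summands of transfinite extensions of modules of the form $S^{-1}R$ with $S$ a countable multiplicative subset of $R$.) *)

(* Defs.v *)
From mathcomp Require Import all_boot all_order all_algebra.
Set Implicit Arguments. Unset Strict Implicit. Unset Printing Implicit Defensive.
Import GRing.Theory.
Local Open Scope ring_scope.

Section Defs.
Variable R : comPzRingType.

Definition is_linear (M N : lmodType R) (f : M -> N) : Prop :=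
  forall (a : R) (x y : M), f (a *: x + y) = a *: f x + f y.

Definition is_bilinear (A B P : lmodType R) (b : A -> B -> P) : Prop :=
  (forall (a : R) (x y : A) (z : B), b (a *: x + y) z = a *: b x z + b y z) /\
  (forall (a : R) (x : A) (y z : B), b x (a *: y + z) = a *: b x y + b x z).

(* The element sum_i a_i (x) b_i of A (x)_R B is zero: by the universal
   property of the tensor product, iff every bilinear map kills it. *)
Definition tensor_zero (A B : lmodType R) (xs : seq (A * B)) : Prop :=
  forall (P : lmodType R) (b : A -> B -> P), is_bilinear b ->
    \sum_(x <- xs) b x.1 x.2 = 0.

Definition flat (F : lmodType R) : Prop :=
  forall (M N : lmodType R) (f : M -> N), is_linear f -> injective f ->
  forall xs : seq (M * F),
    tensor_zero [seq (f x.1, x.2) | x <- xs] -> tensor_zero xs.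

Definition countably_generated (F : lmodType R) : Prop :=
  exists g : nat -> F, forall x : F,
    exists (n : nat) (c : nat -> R), x = \sum_(i < n) c i *: g i.

Definition is_ideal (I : R -> Prop) : Prop :=
  I 0 /\ (forall x y, I x -> I y -> I (x + y)) /\ (forall r x, I x -> I (r * x)).

Definition noetherian : Prop :=
  forall I : R -> Prop, is_ideal I ->
    exists (n : nat) (g : nat -> R), (forall i, (i < n)%N -> I (g i)) /\
      (forall x, I x -> exists c : nat -> R, x = \sum_(i < n) c i * g i).

(* Ext^1_R(M, C) = 0 (Yoneda): every short exact sequence
   0 -> C -> E -> M -> 0 of R-modules splits. *)
Definition ext1_zero (M C : lmodType R) : Prop :=
  forall (E : lmodType R) (i : C -> E) (p : E -> M),
    is_linear i -> is_linear p -> injective i ->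
    (forall m : M, exists e : E, p e = m) ->
    (forall e : E, p e = 0 <-> exists c : C, i c = e) ->
    exists s : M -> E, is_linear s /\ forall m : M, p (s m) = m.

Definition multiplicative (S : R -> Prop) : Prop :=
  S 1 /\ forall x y, S x -> S y -> S (x * y).

Definition countable_subset (S : R -> Prop) : Prop :=
  exists f : nat -> R, forall x, S x -> exists n, f n = x.

(* L is (an R-module isomorphic to) S^{-1}R, via the standard
   characterization of the localization map j : R -> S^{-1}R, r |-> r/1;
   being R-linear, j is r |-> r *: e with e = j 1 = 1/1. *)
Definition is_localization (S : R -> Prop) (L : lmodType R) : Prop :=
  exists e : L,
    (forall s, S s -> bijective (fun x : L => s *: x)) /\
    (forall x : L, exists r s, S s /\ s *: x = r *: e) /\
    (forall r, r *: e = 0 -> exists s, S s /\ s * r = 0).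

Definition almost_cotorsion (C : lmodType R) : Prop :=
  forall S : R -> Prop, multiplicative S -> countable_subset S ->
  forall L : lmodType R, is_localization S L -> ext1_zero L C.

Definition quite_flat (F : lmodType R) : Prop :=
  forall C : lmodType R, almost_cotorsion C -> ext1_zero F C.

End Defs.

(* Main.v *)
Require Import Defs.
From HB Require Import structures.
From mathcomp Require Import all_boot all_order all_algebra.
From mathcomp Require Import boolp functions.
From Stdlib Require Cantor.
Set Implicit Arguments. Unset Strict Implicit. Unset Printing Implicit Defensive.
Import GRing.Theory.
Local Open Scope ring_scope.

(** Over a Noetherian ring, the equational criterion for flatness kills all
    relations of a finite family at once, so [F] is the colimit of a sequence
    of finite free modules [R^(n i)] with matrices [A i].  Hence every extension
    of [F] by [C] splits as soon as every row-finite system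
    [x_i - A_i x_(i+1) = c_i] is solvable in [C] (vanishing of lim^1).
    Almost cotorsion modules solve the systems [x_k - s_k x_(k+1) = c_k] of
    scalars in which every [s_k] recurs infinitely often.

    The general system [T x = c] is solved modulo [J C] by Noetherian induction
    on the ideal [J].  If [a b] is in [J] with [a], [b] not in [J], a solution
    modulo [(J + a) C] leaves an error [a c'], and solving for [c'] modulo
    [(J + b) C] leaves an error in [a b C].  If [J] is prime, the rows of [T] are
    independent over the fraction field of [R/J]; let the [s_k] run through the
    countably many denominators needed to triangularise [T].  Solving modulo
    [(J + s_k) C] successively gives [c^k = T x^k + s_k c^(k+1)]; a formal sum of
    the [x^k], which exists because [C] is almost cotorsion, solves the system
    up to an error on which all the [s_k] act bijectively, and there the
    triangular system can be solved. *)

(** * Submodules and subquotients *)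

Section Submodules.
Variables (R : comPzRingType) (V : lmodType R).

Definition submodule (U : V -> Prop) : Prop :=
  U 0 /\ forall (a : R) (x y : V), U x -> U y -> U (a *: x + y).

Variable U : V -> Prop.
Hypothesis subU : submodule U.

Lemma submodule0 : U 0. Proof. by case: subU. Qed.

Lemma submoduleD x y : U x -> U y -> U (x + y).
Proof. by move=> Ux Uy; rewrite -[x]scale1r; apply: (subU.2). Qed.

Lemma submoduleZ a x : U x -> U (a *: x).
Proof. by move=> Ux; rewrite -[_ *: _]addr0; apply: (subU.2) => //; apply: submodule0. Qed.

Lemma submoduleN x : U x -> U (- x).
Proof. by move=> Ux; rewrite -scaleN1r; apply: submoduleZ. Qed.

Lemma submoduleB x y : U x -> U y -> U (x - y).
Proof. by move=> Ux Uy; apply: submoduleD => //; apply: submoduleN. Qed.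

Lemma submodule_subC x y : U (x - y) -> U (y - x).
Proof. by move=> Uxy; rewrite -opprB; apply: submoduleN. Qed.

Lemma submodule_trans y x z : U (x - y) -> U (y - z) -> U (x - z).
Proof. by move=> Uxy Uyz; rewrite -(subrKA y); apply: submoduleD. Qed.

Lemma submodule_sum (I : Type) (r : seq I) (P : pred I) (f : I -> V) :
  (forall i, P i -> U (f i)) -> U (\sum_(i <- r | P i) f i).
Proof.
move=> Uf; apply: (big_ind U) => //; first exact: submodule0.
exact: submoduleD.
Qed.

End Submodules.

Section LinearMaps.
Variables (R : comPzRingType) (M N : lmodType R) (f : M -> N).
Hypothesis linf : is_linear f.

Lemma is_linearD x y : f (x + y) = f x + f y.
Proof. by have := linf 1 x y; rewrite !scale1r. Qed.

Lemma is_linear0 : f 0 = 0.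
Proof. by apply: (addrI (f 0)); rewrite -is_linearD !addr0. Qed.

Lemma is_linearZ a x : f (a *: x) = a *: f x.
Proof. by have := linf a x 0; rewrite is_linear0 !addr0. Qed.

Lemma is_linearB x y : f (x - y) = f x - f y.
Proof. by rewrite -scaleN1r is_linearD is_linearZ scaleN1r. Qed.

Lemma is_linear_sum (I : Type) (r : seq I) (P : pred I) (F : I -> M) :
  f (\sum_(i <- r | P i) F i) = \sum_(i <- r | P i) f (F i).
Proof. exact: (big_morph f is_linearD is_linear0). Qed.

End LinearMaps.

Section Subquotient.
Variables (R : comPzRingType) (V : lmodType R).

Record submod := Submod { submod_pred :> V -> Prop; submodP : submodule submod_pred }.

Variables U K : submod.

Definition sq_rep (x : V) : V := choose (fun y => `[< U y /\ K (x - y) >]) x.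

Lemma sq_repP x : U x -> U (sq_rep x) /\ K (x - sq_rep x).
Proof.
move=> Ux; apply/asboolP; rewrite /sq_rep.
apply: (@chooseP _ (fun y => `[< U y /\ K (x - y) >])).
by apply/asboolP; rewrite subrr; split=> //; apply: submodule0 (submodP K).
Qed.

(** Congruent elements define equivalent predicates, and [choose] depends only on the predicate once
    its default satisfies it. Hence equality of classes can be Leibniz equality. *)
Lemma sq_rep_eq x y : U x -> U y -> K (x - y) -> sq_rep x = sq_rep y.
Proof.
move=> Ux Uy Kxy; have sK := submodP K; rewrite /sq_rep.
have -> : choose (fun z => `[< U z /\ K (x - z) >]) x =
          choose (fun z => `[< U z /\ K (y - z) >]) x.
  apply: eq_choose => z; apply/asbool_equiv_eq; split=> -[Uz Kz]; split=> //.
    by rewrite -(subrKA x) addrC -[y - x]opprB; apply: submoduleB.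
  by rewrite -(subrKA y); apply: submoduleD.
apply: (@choose_id _ (fun z => `[< U z /\ K (y - z) >])); apply/asboolP; split=> //.
  by rewrite -opprB; apply: submoduleN.
by rewrite subrr; apply: submodule0.
Qed.

(* The elements of [U / K] are canonical representatives of the classes. *)
Definition subquot : Type := {x : V | `[< U x >] && (sq_rep x == x)}.

HB.instance Definition _ := Choice.on subquot.

Lemma sq_zero_subproof : `[< U (sq_rep 0) >] && (sq_rep (sq_rep 0) == sq_rep 0).
Proof.
have U0 := submodule0 (submodP U); have [Ur Kr] := sq_repP U0.
by apply/andP; split; [exact/asboolP | apply/eqP/esym/sq_rep_eq].
Qed.

Definition sq_zero : subquot := Sub (sq_rep 0) sq_zero_subproof.

(** Outside [U] this takes the default value [sq_zero], so the rules below assume membership in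
    [U]. *)
Definition sq_class (x : V) : subquot := insubd sq_zero (sq_rep x).

Definition sq_repr (q : subquot) : V := val q.

Lemma sq_reprP q : U (sq_repr q).
Proof. by have /andP[/asboolP] := valP q. Qed.

Lemma sq_val_class x : U x -> sq_repr (sq_class x) = sq_rep x.
Proof.
move=> Ux; have [Ur Kr] := sq_repP Ux.
rewrite /sq_repr /sq_class val_insubd; case: ifP => // /negP[].
by apply/andP; split; [exact/asboolP | apply/eqP/esym/sq_rep_eq].
Qed.

Lemma sq_reprK q : sq_class (sq_repr q) = q.
Proof.
apply: val_inj; rewrite -/(sq_repr _) sq_val_class; last exact: sq_reprP.
by have /andP[_ /eqP] := valP q.
Qed.

Lemma sq_class_repr x : U x -> K (x - sq_repr (sq_class x)).
Proof. by move=> Ux; rewrite sq_val_class //; case: (sq_repP Ux). Qed.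

Lemma sq_classP x y : U x -> U y -> (sq_class x = sq_class y <-> K (x - y)).
Proof.
move=> Ux Uy; have sK := submodP K; split=> [exy | Kxy].
  rewrite -(subrKA (sq_repr (sq_class x))) {2}exy; apply: submoduleD => //.
    exact: sq_class_repr.
  by rewrite -opprB; apply: submoduleN => //; apply: sq_class_repr.
by apply: val_inj; rewrite -!/(sq_repr _) !sq_val_class //; apply: sq_rep_eq.
Qed.

Definition sq_add (p q : subquot) := sq_class (sq_repr p + sq_repr q).
Definition sq_opp (p : subquot) := sq_class (- sq_repr p).
Definition sq_scale (a : R) (p : subquot) := sq_class (a *: sq_repr p).

Let subU := submodP U.
Let subK := submodP K.

Lemma sq_addE x y : U x -> U y -> sq_add (sq_class x) (sq_class y) = sq_class (x + y).
Proof.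
move=> Ux Uy; apply/esym/sq_classP; [exact: submoduleD| |].
  by apply: submoduleD => //; apply: sq_reprP.
by rewrite opprD addrACA; apply: submoduleD => //; apply: sq_class_repr.
Qed.

Lemma sq_oppE x : U x -> sq_opp (sq_class x) = sq_class (- x).
Proof.
move=> Ux; apply/esym/sq_classP; [exact: submoduleN| |].
  by apply: submoduleN => //; apply: sq_reprP.
by rewrite -opprD; apply: submoduleN => //; apply: sq_class_repr.
Qed.

Lemma sq_scaleE a x : U x -> sq_scale a (sq_class x) = sq_class (a *: x).
Proof.
move=> Ux; apply/esym/sq_classP; [exact: submoduleZ| |].
  by apply: submoduleZ => //; apply: sq_reprP.
by rewrite -scalerBr; apply: submoduleZ => //; apply: sq_class_repr.
Qed.

Lemma sq_ind (P : subquot -> Prop) : (forall x, U x -> P (sq_class x)) -> forall q, P q.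
Proof. by move=> Pc q; rewrite -[q]sq_reprK; apply: Pc; apply: sq_reprP. Qed.

Lemma sq_zeroE : sq_zero = sq_class 0.
Proof. by apply: val_inj; rewrite -[RHS]/(sq_repr _) sq_val_class //; apply: submodule0. Qed.

Lemma sq_addA : associative sq_add.
Proof.
elim/sq_ind=> x Ux; elim/sq_ind=> y Uy; elim/sq_ind=> z Uz.
by rewrite !sq_addE ?addrA //; apply: submoduleD.
Qed.

Lemma sq_addC : commutative sq_add.
Proof. by elim/sq_ind=> x Ux; elim/sq_ind=> y Uy; rewrite !sq_addE // addrC. Qed.

Lemma sq_add0 : left_id sq_zero sq_add.
Proof.
by elim/sq_ind=> x Ux; rewrite sq_zeroE sq_addE ?add0r //; apply: submodule0.
Qed.

Lemma sq_addN : left_inverse sq_zero sq_opp sq_add.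
Proof.
elim/sq_ind=> x Ux; rewrite sq_zeroE sq_oppE // sq_addE ?addNr //.
exact: submoduleN.
Qed.

HB.instance Definition _ :=
  GRing.isZmodule.Build subquot sq_addA sq_addC sq_add0 sq_addN.

Lemma sq_scaleA a b q : sq_scale a (sq_scale b q) = sq_scale (a * b) q.
Proof.
by elim/sq_ind: q => x Ux; rewrite !sq_scaleE ?scalerA //; apply: submoduleZ.
Qed.

Lemma sq_scale1 : left_id 1 sq_scale.
Proof. by elim/sq_ind=> x Ux; rewrite sq_scaleE ?scale1r. Qed.

Lemma sq_scaleDr : right_distributive sq_scale +%R.
Proof.
move=> a; elim/sq_ind=> x Ux; elim/sq_ind=> y Uy.
by rewrite /+%R /= !(sq_scaleE, sq_addE) ?scalerDr //;
   (exact: submoduleZ || exact: submoduleD).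
Qed.

Lemma sq_scaleDl q : {morph sq_scale^~ q : a b / a + b}.
Proof.
move=> a b; elim/sq_ind: q => x Ux.
by rewrite {2}/+%R /= !(sq_scaleE, sq_addE) ?scalerDl //; apply: submoduleZ.
Qed.

HB.instance Definition _ :=
  GRing.Zmodule_isLmodule.Build R subquot sq_scaleA sq_scale1 sq_scaleDr sq_scaleDl.

Lemma sq_class_linear a x y :
  U x -> U y -> sq_class (a *: x + y) = a *: sq_class x + sq_class y.
Proof.
move=> Ux Uy; have Uax : U (a *: x) by apply: submoduleZ.
by rewrite -sq_addE // -sq_scaleE.
Qed.

Lemma sq_classZ a x : U x -> sq_class (a *: x) = a *: sq_class x.
Proof. by move=> Ux; rewrite -sq_scaleE. Qed.

Lemma sq_class0 x : U x -> (sq_class x = 0 <-> K x).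
Proof.
move=> Ux; rewrite -[X in K X]subr0 -[0 in X in X <-> _]/sq_zero sq_zeroE.
by apply: sq_classP => //; apply: submodule0.
Qed.

End Subquotient.

(** * Almost cotorsion modules and telescopes *)

Section SequentialColimit.
Variables (R : comPzRingType) (V : lmodType R) (phi : nat -> V -> V).
Hypothesis phi_lin : forall i, is_linear (phi i).

Definition coherent_from N (u : nat -> V) := forall i, (N <= i)%N -> u i.+1 = phi i (u i).

Lemma coherent_fromW N M u : (N <= M)%N -> coherent_from N u -> coherent_from M u.
Proof. by move=> NM cu i Mi; apply: cu; apply: leq_trans Mi. Qed.

Lemma coherent_eq N u v :
  coherent_from N u -> coherent_from N v -> u N = v N ->
  forall i, (N <= i)%N -> u i = v i.
Proof.
move=> cu cv uv i /subnKC<-; elim: (i - N)%N => [|d IHd]; first by rewrite addn0.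
by rewrite addnS cu ?cv ?leq_addr // IHd.
Qed.

Lemma coherent_submodule : submodule (fun u => exists N, coherent_from N u).
Proof.
split=> [|a u v [N cu] [M cv]]; first by exists 0%N => i _; rewrite /= (is_linear0 (phi_lin i)).
exists (maxn N M) => i; rewrite geq_max => /andP[Ni Mi].
by rewrite /= !fctE cu // cv // (phi_lin i).
Qed.

Lemma eventually0_submodule :
  submodule (fun u : nat -> V => exists N, forall i, (N <= i)%N -> u i = 0).
Proof.
split=> [|a u v [N cu] [M cv]]; first by exists 0%N.
exists (maxn N M) => i; rewrite geq_max => /andP[Ni Mi].
by rewrite /= !fctE cu // cv // scaler0 addr0.
Qed.

(* The colimit of [V -phi 0-> V -phi 1-> V -> ...], realised as eventually
   coherent sequences modulo eventually zero ones. *)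
Definition seq_colim : lmodType R :=
  subquot (Submod coherent_submodule) (Submod eventually0_submodule).

Definition colim_class (u : nat -> V) : seq_colim :=
  sq_class (Submod coherent_submodule) (Submod eventually0_submodule) u.

Lemma colim_ind (P : seq_colim -> Prop) :
  (forall N u, coherent_from N u -> P (colim_class u)) -> forall q, P q.
Proof. by move=> Pc; elim/sq_ind=> u [N cu]; apply: Pc cu. Qed.

Lemma colim_class_linear N M a u v : coherent_from N u -> coherent_from M v ->
  colim_class (a *: u + v) = a *: colim_class u + colim_class v.
Proof. by move=> cu cv; apply: sq_class_linear; [exists N | exists M]. Qed.

Lemma colim_classZ N a u : coherent_from N u -> colim_class (a *: u) = a *: colim_class u.
Proof. by move=> cu; apply: sq_classZ; exists N. Qed.

Lemma colim_class0 N u : coherent_from N u ->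
  (colim_class u = 0 <-> exists M, forall i, (M <= i)%N -> u i = 0).
Proof. by move=> cu; apply: sq_class0; exists N. Qed.

Lemma coherent0 N u : coherent_from N u -> u N = 0 -> colim_class u = 0.
Proof.
move=> cu uN; apply/(colim_class0 cu); exists N.
apply: (coherent_eq (v := fun=> 0)) => // i _.
by rewrite (is_linear0 (phi_lin i)).
Qed.

Lemma colim_class_eq N M u v : coherent_from N u -> coherent_from M v ->
  (exists K, forall i, (K <= i)%N -> u i = v i) -> colim_class u = colim_class v.
Proof.
move=> cu cv [K uv]; apply/sq_classP; [by exists N | by exists M|].
by exists K => i Ki; rewrite /= !fctE uv ?subrr.
Qed.

Fixpoint push n (v : V) d := if d is d'.+1 then phi (n + d') (push n v d') else v.

(** The element [v] of stage [n], carried along [phi]. By truncated subtraction the entries below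
    [n] are [v] itself; only tails matter in the colimit. *)
Definition at_level n v : nat -> V := fun j => push n v (j - n).

Lemma at_level_coherent n v : coherent_from n (at_level n v).
Proof. by move=> i ni; rewrite /at_level subSn //= subnKC. Qed.

Lemma at_level_id n v : at_level n v n = v.
Proof. by rewrite /at_level subnn. Qed.

End SequentialColimit.

(** Unpairing makes every value recur infinitely often, so each [f a] equals [f (recur k)] for
    arbitrarily large [k]. *)
Definition recur (k : nat) : nat := (Cantor.of_nat k).1.

Lemma recurP a n : exists2 m, (n <= m)%N & recur m = a.
Proof.
exists (Cantor.to_nat (a, n)); last by rewrite /recur Cantor.cancel_of_to.
by have /leP := Cantor.to_nat_non_decreasing a n; apply: leq_trans; apply: leq_addr.
Qed.

(** The element [eE k - s (eL k)] is killed by [p], hence comes from some [x k] in [C]; subtracting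
    the two recurrences gives the system. *)
Lemma section_telescope (R : comPzRingType) (C E L : lmodType R) (t : nat -> R)
    (c : nat -> C) (j : C -> E) (p : E -> L) (s : L -> E) :
  is_linear j -> is_linear p -> is_linear s -> injective j ->
  (forall e, p e = 0 <-> exists a, j a = e) -> (forall m, p (s m) = m) ->
  forall (eL : nat -> L) (eE : nat -> E),
  (forall k, eL k = t k *: eL k.+1) ->
  (forall k, eE k = t k *: eE k.+1 + j (c k)) ->
  (forall k, p (eE k) = eL k) ->
  exists x : nat -> C, forall k, x k - t k *: x k.+1 = c k.
Proof.
move=> linj linp lins injj exactp sK eL eE eLS eES peE.
have /choice[x xP] k : exists a, j a = eE k - s (eL k).
  by apply/exactp; rewrite (is_linearB linp) sK peE subrr.
exists x => k; apply: injj.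
rewrite (is_linearB linj) (is_linearZ linj) !xP (eES k) (eLS k) (is_linearZ lins).
by rewrite scalerBr [_ + j _]addrC -[X in X - _]addrA addrK.
Qed.

(** * Localization at a countably generated monoid as a telescope *)

Section Telescope.
Variables (R : comPzRingType) (f : nat -> R).

Let t k := f (recur k).
Definition loc_map (k : nat) (x : R^o) : R^o := t k *: x.

Lemma loc_map_linear k : is_linear (loc_map k).
Proof. by move=> a x y; rewrite /loc_map scalerDr !scalerA mulrC. Qed.

Definition generated_monoid (x : R) := exists l : seq nat, x = \prod_(a <- l) f a.

Lemma generated_monoid_multiplicative : Defs.multiplicative generated_monoid.
Proof.
split; first by exists [::]; rewrite big_nil.
by move=> _ _ [l ->] [l' ->]; exists (l ++ l'); rewrite big_cat.
Qed.

Lemma generated_monoid_countable : countable_subset generated_monoid.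
Proof.
exists (fun n => \prod_(a <- odflt [::] (unpickle n)) f a) => _ [l ->].
by exists (pickle l); rewrite pickleK.
Qed.

Let L := seq_colim loc_map_linear.
Let cl : (nat -> R^o) -> L := colim_class loc_map_linear.

(** If [f a *: u] vanishes from some index on, the next transition map with scalar [f a] kills [u].
    Such a map also gives [u m.+1 = f a *: u m], so the class of [u] is [f a] times that of [u m]
    placed at level [m.+1]. *)
Lemma scale_generator_bij a : bijective (fun x : L => f a *: x).
Proof.
have inj : injective (fun x : L => f a *: x).
  move=> x y /= exy; apply/eqP; rewrite -subr_eq0; apply/eqP.
  have: f a *: (x - y) = 0 by rewrite scalerBr exy subrr.
  elim/colim_ind: (x - y) => N u cu; rewrite -(colim_classZ _ _ cu) => fu0.
  have cfu : coherent_from loc_map N (f a *: u).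
    move=> i Ni; rewrite -[(f a *: u) i.+1]/(f a *: u i.+1) cu //.
    by rewrite /loc_map !scalerA mulrC.
  have [M uM] := (colim_class0 loc_map_linear cfu).1 fu0.
  have [m mM rm] := recurP a (maxn N M); move: mM; rewrite geq_max => /andP[Nm Mm].
  apply: (@coherent0 _ _ _ _ m.+1).
    by apply: coherent_fromW cu; apply: leqW.
  by rewrite cu // /loc_map /t rm; apply: uM.
have surj : forall y : L, exists x : L, f a *: x = y.
  elim/colim_ind=> N u cu; have [m Nm rm] := recurP a N.
  pose v := at_level loc_map m.+1 (u m).
  have cv : coherent_from loc_map m.+1 v by apply: at_level_coherent.
  have cfv : coherent_from loc_map m.+1 (f a *: v).
    move=> i Ni; rewrite -[(f a *: v) i.+1]/(f a *: v i.+1) cv //.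
    by rewrite /loc_map !scalerA mulrC.
  exists (cl v); rewrite -(colim_classZ _ _ cv).
  apply: (colim_class_eq _ cfv cu); exists m.+1.
  have cu' : coherent_from loc_map m.+1 u by apply: coherent_fromW cu; apply: leqW.
  apply: (coherent_eq cfv cu').
  by rewrite -[(f a *: v) _]/(f a *: v _) /v at_level_id cu // /loc_map /t rm.
have [g gP] := choice surj; exists g => x; last exact: gP.
by apply: inj; rewrite /= gP.
Qed.

Lemma at_level0E N : at_level loc_map 0 (1 : R^o) N = \prod_(0 <= i < N) t i.
Proof.
elim: N => [|N IHN]; first by rewrite big_nil at_level_id.
rewrite big_nat_recr //= (@at_level_coherent _ _ loc_map 0) // IHN mulrC //.
Qed.

Lemma prod_generated N : generated_monoid (\prod_(0 <= i < N) t i).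
Proof. by exists (map recur (index_iota 0 N)); rewrite big_map. Qed.

(** The unit is the image of [1] from level 0. At level [N] it becomes the product of the first [N]
    scalars; this product clears the denominator of an element living at level [N], and it kills [r]
    when [r] times the unit vanishes there. *)
Lemma telescope_localization : is_localization generated_monoid L.
Proof.
have ce := @at_level_coherent _ _ loc_map 0 (1 : R^o).
exists (cl (at_level loc_map 0 (1 : R^o))); split; last split.
- move=> _ [l ->]; elim: l => [|a l IHl].
    by exists id => x; rewrite big_nil scale1r.
  apply: (eq_bij (bij_comp (scale_generator_bij a) IHl)) => x /=.
  by rewrite big_cons scalerA.
- elim/colim_ind=> N u cu; exists (u N), (\prod_(0 <= i < N) t i).
  split; first exact: prod_generated.
  rewrite -(colim_classZ _ _ cu) -(colim_classZ _ _ ce).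
  have cZ (b : R) M w : coherent_from loc_map M w -> coherent_from loc_map M (b *: w).
    move=> cw i Ni; rewrite -[(b *: w) i.+1]/(b *: w i.+1) cw //.
    by rewrite /loc_map !scalerA mulrC.
  apply: (colim_class_eq _ (cZ _ _ _ cu) (cZ _ _ _ ce)); exists N.
  apply: (coherent_eq (cZ _ _ _ cu) (cZ _ _ _ (coherent_fromW (leq0n N) ce))).
  rewrite -[(_ *: u) N]/(_ * u N) -[RHS]/(u N * at_level loc_map 0 1 N) at_level0E.
  exact: mulrC.
- move=> r; rewrite -(colim_classZ _ _ ce).
  have cr : coherent_from loc_map 0 (r *: at_level loc_map 0 (1 : R^o)).
    move=> i Ni; rewrite -[(_ *: _) i.+1]/(r *: at_level loc_map 0 1 i.+1) ce //.
    by rewrite /loc_map !scalerA mulrC.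
  move/(colim_class0 loc_map_linear cr) => [N /(_ N (leqnn N)) rN].
  exists (\prod_(0 <= i < N) t i); split; first exact: prod_generated.
  by rewrite mulrC -at_level0E.
Qed.

Variables (C : lmodType R) (c : nat -> C).

(** Triangular transition maps: they fix [C] and induce [loc_map k] on the quotient, so their
    colimit is an extension of the localization by [C], twisted by the [c k]. *)
Definition ext_map (k : nat) (x : C * R^o) : C * R^o :=
  (x.1 + (x.2 : R) *: c k, loc_map k x.2).

Lemma ext_map_linear k : is_linear (ext_map k).
Proof.
move=> a [x r] [y s]; congr pair; rewrite /= ?loc_map_linear //.
by rewrite scalerDl -scalerA scalerDr addrACA.
Qed.

Let E := seq_colim ext_map_linear.
Let clE : (nat -> C * R^o) -> E := colim_class ext_map_linear.

(** The extension [E] of [L] by [C] splits because [C] is almost cotorsion; the images of [(0, 1)]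
    from the successive levels then feed [section_telescope]. *)
Lemma telescope_solvable : almost_cotorsion C ->
  exists x : nat -> C, forall k, x k - f (recur k) *: x k.+1 = c k.
Proof.
move=> /(_ _ generated_monoid_multiplicative generated_monoid_countable
          _ telescope_localization) extL.
pose cst (a : C) : nat -> C * R^o := fun=> (a, 0).
have ccst a : coherent_from ext_map 0 (cst a).
  move=> i _; rewrite /cst /ext_map /= scale0r addr0.
  by rewrite (is_linear0 (@loc_map_linear i)).
pose j (a : C) : E := clE (cst a).
pose sec (w : nat -> C * R^o) : nat -> R^o := fun i => (w i).2.
have csec N w : coherent_from ext_map N w -> coherent_from loc_map N (sec w).
  by move=> cw i Ni; rewrite /sec cw.
pose p (q : E) : L := cl (sec (sq_repr q)).
(* The map [p] reads a chosen representative, which agrees with any given one from some index on. *)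
have reprE N w : coherent_from ext_map N w -> exists M K,
    coherent_from ext_map M (sq_repr (clE w)) /\
    forall i, (K <= i)%N -> w i = sq_repr (clE w) i.
  move=> cw; have [M cM] := sq_reprP (clE w).
  have [|K wK] := @sq_class_repr _ _ (Submod (coherent_submodule ext_map_linear))
    (Submod (@eventually0_submodule R (C * R^o)%type)) w; first by exists N.
  by exists M, K; split=> // i Ki; apply/eqP; rewrite -subr_eq0; apply/eqP/wK.
have pE N w : coherent_from ext_map N w -> p (clE w) = cl (sec w).
  move=> cw; have [M [K [cM wK]]] := reprE _ _ cw.
  apply: (colim_class_eq _ (csec _ _ cM) (csec _ _ cw)); exists K => i Ki.
  by rewrite /sec wK.
have linj : is_linear j.
  move=> a x y; rewrite /j -(colim_class_linear _ _ (ccst x) (ccst y)).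
  congr clE; apply/funext => i; rewrite /cst /= !fctE; congr pair => /=.
  by rewrite scaler0 addr0.
have linp : is_linear p.
  move=> a; elim/colim_ind=> N u cu; elim/colim_ind=> M v cv.
  rewrite -(colim_class_linear _ _ cu cv).
  have cuv : coherent_from ext_map (maxn N M) (a *: u + v).
    move=> i; rewrite geq_max => /andP[Ni Mi].
    by rewrite !fctE cu // cv // (ext_map_linear i).
  rewrite (pE _ _ cuv) (pE _ _ cu) (pE _ _ cv).
  by rewrite -(colim_class_linear _ _ (csec _ _ cu) (csec _ _ cv)).
have injj : injective j.
  move=> x y exy; apply/eqP; rewrite -subr_eq0; apply/eqP.
  have: j (x - y) = 0 by rewrite (is_linearB linj) exy subrr.
  by move=> /(colim_class0 ext_map_linear (ccst _)) [M /(_ M (leqnn M)) []].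
have surjp q : exists w, p w = q.
  elim/colim_ind: q => N u cu.
  have cw := @at_level_coherent _ _ ext_map N (0, u N).
  exists (clE (at_level ext_map N (0, u N))); rewrite (pE _ _ cw).
  apply: (colim_class_eq _ (csec _ _ cw) cu); exists N.
  by apply: (coherent_eq (csec _ _ cw) cu); rewrite /sec at_level_id.
have exactp q : p q = 0 <-> exists a, j a = q.
  split=> [|[a <-]]; last first.
    rewrite (pE _ _ (ccst a)); apply: (coherent0 _ (csec _ _ (ccst a))) => //.
  elim/colim_ind: q => N w cw; rewrite (pE _ _ cw).
  move=> /(colim_class0 loc_map_linear (csec _ _ cw)) [M wM].
  pose K := maxn N M; have cK : coherent_from ext_map K w.
    by apply: coherent_fromW cw; apply: leq_maxl.
  exists (w K).1; apply: (colim_class_eq _ (ccst _) cK); exists K.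
  apply: (coherent_eq (coherent_fromW (leq0n K) (ccst _)) cK).
  by rewrite /cst [RHS]surjective_pairing; congr pair; rewrite [RHS]wM // leq_maxr.
have [s [lins sK]] := extL E j p linj linp injj surjp exactp.
pose eL k : L := cl (at_level loc_map k (1 : R^o)).
pose eE k : E := clE (at_level ext_map k (0, 1)).
have eLS k : eL k = t k *: eL k.+1.
  have c1 := @at_level_coherent _ _ loc_map k (1 : R^o).
  have c2 := @at_level_coherent _ _ loc_map k.+1 (1 : R^o).
  rewrite /eL -(colim_classZ _ _ c2).
  have c3 : coherent_from loc_map k.+1 (t k *: at_level loc_map k.+1 (1 : R^o)).
    move=> i Ni; rewrite -[(_ *: _) i.+1]/(t k *: at_level loc_map k.+1 1 i.+1) c2 //.
    by rewrite /loc_map !scalerA mulrC.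
  apply: (colim_class_eq _ c1 c3); exists k.+1.
  apply: (coherent_eq (coherent_fromW (leqnSn k) c1) c3).
  by rewrite c1 // -[(_ *: _) k.+1]/(t k *: at_level loc_map k.+1 1 k.+1) !at_level_id.
have eES k : eE k = t k *: eE k.+1 + j (c k).
  have c1 := @at_level_coherent _ _ ext_map k (0, 1 : R^o).
  have c2 := @at_level_coherent _ _ ext_map k.+1 (0, 1 : R^o).
  rewrite /eE -(colim_class_linear _ _ c2 (ccst _)).
  have c3 : coherent_from ext_map k.+1
      (t k *: at_level ext_map k.+1 (0, 1 : R^o) + cst (c k)).
    move=> i Ni; rewrite !fctE c2 // (ext_map_linear i).
    by rewrite -(ccst (c k) i).
  apply: (colim_class_eq _ c1 c3); exists k.+1.
  apply: (coherent_eq (coherent_fromW (leqnSn k) c1) c3).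
  rewrite c1 // !fctE !at_level_id /ext_map /cst /=; congr pair => /=.
    by rewrite scaler0 scale1r.
  by rewrite addr0.
have peE k : p (eE k) = eL k.
  have c1 := @at_level_coherent _ _ ext_map k (0, 1 : R^o).
  have c2 := @at_level_coherent _ _ loc_map k (1 : R^o).
  rewrite (pE _ _ c1); apply: (colim_class_eq _ (csec _ _ c1) c2); exists k.
  by apply: (coherent_eq (csec _ _ c1) c2); rewrite /sec !at_level_id.
exact: (@section_telescope _ C E L t c j p s linj linp lins injj exactp sK eL eE).
Qed.

End Telescope.

(** * Row-finite systems *)

(** Course-of-values recursion with choice: the condition on the [n]-th value may involve all values
    chosen before it. *)
Lemma history_choice (X : Type) (x0 : X) (P : nat -> (nat -> X) -> X -> Prop) :
  (forall n g g' x, (forall i, (i < n)%N -> g i = g' i) -> P n g x -> P n g' x) ->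
  (forall n g, exists x, P n g x) -> exists g, forall n, P n g (g n).
Proof.
move=> Pext Pex.
have [F FP] := choice (fun ng : nat * (nat -> X) => Pex ng.1 ng.2).
(* [b n] is the table of the values chosen below [n], filled with [x0] from [n] on. *)
pose b := nat_rect (fun=> nat -> X) (fun=> x0)
  (fun n bn i => if i == n then F (n, bn) else bn i).
exists (fun n => F (n, b n)) => n; apply: (Pext n (b n)); last exact: (FP (n, b n)).
elim: n => // n IHn i; rewrite ltnS leq_eqVlt /=.
by case: eqP => [-> //|_ /=]; apply: IHn.
Qed.

(** * Noetherian induction and the submodules [J C] *)

Section Ideals.
Variable R : comPzRingType.
Implicit Types I J : R -> Prop.

Lemma ideal_submodule J : is_ideal J -> submodule (V := R^o) J.
Proof. by move=> [J0 [JD JM]]; split=> // a x y Jx Jy; apply: JD => //; apply: JM. Qed.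

(** A failure of [G] passes to a strictly larger ideal, so dependent choice yields a strictly
    ascending chain. The finitely many generators of its union lie in one member, which therefore
    contains the next one. *)
Lemma noetherian_ind (G : (R -> Prop) -> Prop) : noetherian R ->
  (forall J, is_ideal J ->
     (forall J', is_ideal J' -> (forall x, J x -> J' x) ->
        (exists x, J' x /\ ~ J x) -> G J') -> G J) ->
  forall J, is_ideal J -> G J.
Proof.
move=> noeth Gstep J0 idJ0; apply: contrapT => nGJ0.
pose X := {J : R -> Prop | is_ideal J /\ ~ G J}.
pose lt (J J' : X) := (forall x, sval J x -> sval J' x) /\ exists x, sval J' x /\ ~ sval J x.
have next (J : X) : {J' : X | lt J J'}.
  apply: cid; apply: contrapT => noJ'; case: (svalP J) => idJ; apply.
  apply: Gstep => // J' idJ' JJ' J'x; apply: contrapT => nGJ'; apply: noJ'.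
  by exists (exist _ J' (conj idJ' nGJ')).
have [F [_ FS]] := dependent_choice next (exist _ J0 (conj idJ0 nGJ0)).
have mono m n x : (m <= n)%N -> sval (F m) x -> sval (F n) x.
  move=> /subnKC<- Fx; elim: (n - m)%N => [|d IHd]; first by rewrite addn0.
  by rewrite addnS; apply: (FS _).1.
have idF n : is_ideal (sval (F n)) by case: (svalP (F n)).
have [n [g [gF gspan]]] : exists n (g : nat -> R),
    (forall i, (i < n)%N -> exists k, sval (F k) (g i)) /\
    forall x, (exists k, sval (F k) x) -> exists c : nat -> R, x = \sum_(i < n) c i * g i.
  apply: (noeth (fun x => exists k, sval (F k) x)); split; first by exists 0%N; case: (idF 0%N).
  split=> [x y [k Fx] [l Fy] | r x [k Fx]].
    exists (maxn k l); case: (idF (maxn k l)) => _ [FD _].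
    by apply: FD; [apply: mono Fx; apply: leq_maxl | apply: mono Fy; apply: leq_maxr].
  by exists k; case: (idF k) => _ [_ FM]; apply: FM.
have [K gK] : exists K, forall i, (i < n)%N -> sval (F K) (g i).
  elim: n gF {gspan} => [|n IHn] gF; first by exists 0%N.
  have [|K gK] := IHn; first by move=> i ltin; apply: gF; apply: leqW.
  have [k gk] := gF n (leqnn _); exists (maxn K k) => i.
  rewrite ltnS leq_eqVlt => /orP[/eqP-> | ltin].
    by apply: mono gk; apply: leq_maxr.
  by apply: mono (gK i ltin); apply: leq_maxl.
have [_ [x [Fx]]] := FS K; apply.
have [|c ->] := gspan x; first by exists K.+1.
apply: (submodule_sum (ideal_submodule (idF K))) => i _.
by case: (idF K) => _ [_ FM]; apply: FM; apply: gK.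
Qed.

Definition adjoin J (a : R) : R -> Prop := fun x => exists j r, J j /\ x = j + r * a.

Lemma adjoin_ideal J a : is_ideal J -> is_ideal (adjoin J a).
Proof.
move=> [J0 [JD JM]]; split; first by exists 0, 0; rewrite mul0r addr0.
split=> [_ _ [j [r [Jj ->]]] [k [s [Jk ->]]] | b _ [j [r [Jj ->]]]].
  by exists (j + k), (r + s); rewrite mulrDl addrACA; split=> //; apply: JD.
by exists (b * j), (b * r); rewrite mulrDr mulrA; split=> //; apply: JM.
Qed.

Lemma sub_adjoin J a x : J x -> adjoin J a x.
Proof. by move=> Jx; exists x, 0; rewrite mul0r addr0. Qed.

Lemma adjoin_gen J a : is_ideal J -> adjoin J a a.
Proof. by move=> [J0 _]; exists 0, 1; rewrite add0r mul1r. Qed.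

(** The submodule [J C] as an intersection, so that membership is exploited by exhibiting a suitable
    [D] instead of handling finite sums. *)
Definition ideal_mul J (C : lmodType R) : C -> Prop := fun x =>
  forall D : C -> Prop, submodule D -> (forall a y, J a -> D (a *: y)) -> D x.

Lemma ideal_mul_submodule J C : submodule (@ideal_mul J C).
Proof.
split=> [D sD _|a x y Jx Jy D sD DJ]; first exact: submodule0 sD.
by apply: sD.2; [apply: Jx | apply: Jy].
Qed.

Lemma mem_ideal_mul J (C : lmodType R) a (y : C) : J a -> ideal_mul J (a *: y).
Proof. by move=> Ja D _; apply. Qed.

Lemma ideal_mul_adjoin J a (C : lmodType R) (x : C) : is_ideal J ->
  ideal_mul (adjoin J a) x -> exists y, ideal_mul J (x - a *: y).
Proof.
move=> idJ; have sJ := ideal_mul_submodule J C.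
move=> /(_ (fun x => exists y, ideal_mul J (x - a *: y))); apply.
  split=> [|b u v [y Jy] [z Jz]].
    by exists 0; rewrite scaler0 subrr; apply: submodule0 sJ.
  exists (b *: y + z); rewrite scalerDr opprD addrACA scalerA [a * b]mulrC -scalerA.
  by rewrite -scalerBr; apply: sJ.2.
move=> _ y [j [r [Jj ->]]]; exists (r *: y).
by rewrite scalerDl scalerA [a * r]mulrC addrK; apply: mem_ideal_mul.
Qed.

End Ideals.

(** * Row-finite systems, unitriangular with respect to a level function *)

Section RowFinite.
Variables (R : comPzRingType) (T : nat -> nat -> R) (N lev : nat -> nat).
Hypothesis T_diag : forall m, T m m = 1.
Hypothesis T_upper : forall m j, m != j -> (lev j <= lev m)%N -> T m j = 0.
Hypothesis T_finite : forall m j, (N m <= j)%N -> T m j = 0.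

Definition row_app (V : lmodType R) (m : nat) (x : nat -> V) : V :=
  \sum_(0 <= j < N m) T m j *: x j.

Lemma row_appE (V : lmodType R) B m (x : nat -> V) : (N m <= B)%N ->
  row_app m x = \sum_(0 <= j < B) T m j *: x j.
Proof.
move=> NB; rewrite /row_app (@big_cat_nat _ _ _ (N m) 0 B) //=.
rewrite [X in _ + X]big_nat [X in _ + X]big1 ?addr0 // => j /andP[Nj _].
by rewrite T_finite ?scale0r.
Qed.

Lemma row_appD (V : lmodType R) m (x y : nat -> V) :
  row_app m (fun j => x j + y j) = row_app m x + row_app m y.
Proof. by rewrite /row_app -big_split; apply: eq_bigr => j _; rewrite scalerDr. Qed.

Lemma row_appZ (V : lmodType R) m a (x : nat -> V) :
  row_app m (fun j => a *: x j) = a *: row_app m x.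
Proof.
rewrite /row_app scaler_sumr; apply: eq_bigr => j _ /=.
by rewrite !scalerA mulrC.
Qed.

Section PrimeIdeal.
Variable J : R -> Prop.
Hypothesis idJ : is_ideal J.
Hypothesis J_proper : ~ J 1.
Hypothesis J_prime : forall a b, J (a * b) -> J a \/ J b.

Let sJ := ideal_submodule idJ.

Lemma prime_mulNr a b : ~ J a -> ~ J b -> ~ J (a * b).
Proof. by move=> nJa nJb /J_prime[]. Qed.

Lemma ideal_mulr a b : J a -> J (a * b).
Proof. by move=> Ja; rewrite mulrC; apply: (submoduleZ sJ). Qed.

Lemma ideal_mull a b : J b -> J (a * b).
Proof. by move=> Jb; apply: (submoduleZ sJ). Qed.

(** Induction on the level: column [l] meets only row [l], with entry 1, and rows of smaller level,
    whose coefficients are already known to lie in [J]. *)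
Lemma rows_independent n (u : nat -> R) :
  (forall j, J (\sum_(l < n) u l * T l j)) -> forall l, (l < n)%N -> J (u l).
Proof.
move=> Ju l; have [k] := ubnP (lev l); elim: k l => // k IHk l ltlk ltln.
have := Ju l; rewrite (bigD1 (Ordinal ltln)) //= T_diag mulr1 => Jl.
rewrite -[u l](addrK (\sum_(i < n | i != Ordinal ltln) u i * T i l)).
apply: (submoduleB sJ) => //; apply: (submodule_sum sJ) => i nil.
have [le_ll|lt_ll] := leqP (lev l) (lev i).
  by rewrite T_upper ?mulr0 //; apply: (submodule0 sJ).
by apply: ideal_mulr; apply: IHk => //; apply: leq_trans lt_ll _; rewrite -ltnS.
Qed.

Definition comb m (u : nat -> R) j : R := \sum_(l < m.+1) u l * T l j.

Lemma comb_widen l m u j : (l <= m)%N ->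
  comb l u j = comb m (fun k => if (k <= l)%N then u k else 0) j.
Proof.
move=> lem; rewrite /comb (big_ord_widen_cond m.+1 xpredT (fun k => u k * T k j)) //.
rewrite big_mkcond; apply: eq_bigr => k _ /=; rewrite ltnS.
by case: ifP => //; rewrite mul0r.
Qed.

Lemma comb_lin m a b u v j :
  comb m (fun k => a * u k - b * v k) j = a * comb m u j - b * comb m v j.
Proof.
by rewrite /comb !mulr_sumr -sumrB; apply: eq_bigr => k _; rewrite mulrBl !mulrA.
Qed.

(* Among the combinations of the rows [0 .. m] involving row [m], take one whose
   last column [p] is minimal: two rows with the same [p] could be combined to
   lower it, so distinct rows get distinct [p]. *)
Lemma pivot m : exists pu : nat * (nat -> R), let: (p, u) := pu in
  [/\ ~ J (u m), ~ J (comb m u p), forall j, (p < j)%N -> J (comb m u j) &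
      forall v, (forall j, (p <= j)%N -> J (comb m v j)) -> J (v m)].
Proof.
pose Q p := exists u, ~ J (u m) /\ forall j, (p <= j)%N -> J (comb m u j).
have exQ : exists p, `[< Q p >].
  exists (N m); apply/asboolP; exists (fun l => (l == m)%:R); rewrite eqxx; split=> // j Nj.
  apply: (submodule_sum sJ) => l _.
  by case: eqP => [->|_]; rewrite ?mul0r ?T_finite ?mulr0 //; apply: (submodule0 sJ).
case: (ex_minnP exQ) => p /asboolP[u [nJu Ju]] minp.
(* The least bound is not 0, since the rows are independent modulo [J]; its predecessor is the last
   column with an entry outside [J]. *)
case: p => [|p] in Ju minp *.
  case: nJu; apply: (@rows_independent m.+1) => // j; exact: Ju.
have min v : (forall j, (p <= j)%N -> J (comb m v j)) -> J (v m).
  move=> Jv; apply: contrapT => nJv; suff: (p < p)%N by rewrite ltnn.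
  by apply: minp; apply/asboolP; exists v.
exists (p, u); split=> // Jp; apply: nJu; apply: min => j.
by rewrite leq_eqVlt => /orP[/eqP<- //|]; apply: Ju.
Qed.

Section Triangular.
Variables (V : lmodType R) (H E : V -> Prop).
Hypotheses (subH : submodule H) (subE : submodule E).
Hypothesis JHE : forall a h, J a -> H h -> E (a *: h).

(* The last columns [p m] of the combined rows being distinct, the unknowns can
   be determined in increasing order of columns. *)
Lemma triangular_solve (p : nat -> nat) (u : nat -> nat -> R) :
  (forall m j, (p m < j)%N -> J (comb m (u m) j)) ->
  injective p ->
  (forall m h, H h -> exists2 h', H h' & E (comb m (u m) (p m) *: h' - h)) ->
  (forall m h, H h -> E (u m m *: h) -> E h) ->
  forall d : nat -> V, (forall m, H (d m)) ->
  exists2 z : nat -> V, forall j, H (z j) & forall m, E (row_app m z - d m).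
Proof.
move=> Jp injp divH injH d Hd.
pose d' m : V := \sum_(l < m.+1) u m l *: d l.
have Hd' m : H (d' m) by apply: (submodule_sum subH) => l _; apply: (submoduleZ subH).
(* Condition on the unknown [j]: it solves the combined row with pivot column [j], the unknowns of
   smaller columns being substituted. *)
pose P j (z : nat -> V) (x : V) := (forall i, (i < j)%N -> H (z i)) ->
  H x /\ forall m, p m = j ->
    E (comb m (u m) j *: x - (d' m - \sum_(0 <= i < j) comb m (u m) i *: z i)).
have [|j z|z zP] := @history_choice V 0 P.
- move=> j z z' x zz' Pz Hz'.
  have [|Hx xP] := Pz; first by move=> i ltij; rewrite zz' //; apply: Hz'.
  split=> // m pm; have := xP m pm; rewrite !big_nat.
  by under eq_bigr => i /andP[_ ltij] do rewrite zz' //.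
- have [Hz|nHz] := pselect (forall i, (i < j)%N -> H (z i)); last by exists 0 => /nHz.
  (* A column that is the pivot of no row is free and gets the value 0; otherwise the row is unique
     by injectivity of [p]. *)
  have [[m pm]|nop] := pselect (exists m, p m = j); last first.
    by exists 0 => _; split=> [|m pm]; [apply: submodule0 | case: nop; exists m].
  have [|h' Hh' Eh'] := divH m (d' m - \sum_(0 <= i < j) comb m (u m) i *: z i).
    apply: (submoduleB subH) => //; rewrite big_nat; apply: (submodule_sum subH).
    by move=> i /andP[_ /Hz]; apply: submoduleZ.
  by exists h' => _; split=> // m'; rewrite -{1}pm => /injp ->; rewrite -{1}pm.
have Hz j : H (z j).
  have [k] := ubnP j; elim: k j => // k IHk j ltjk.
  by case: (zP j) => // i ltij; apply: IHk; apply: leq_trans ltij _.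
exists z => // m.
have [k] := ubnP m; elim: k m => // k IHk m ltmk.
pose B := (\sum_(l < m.+1) N l + (p m).+1)%N.
have NB l : (l <= m)%N -> (N l <= B)%N.
  move=> lem; apply: leq_trans (leq_addr _ _).
  by rewrite (bigD1 (Ordinal (lem : (l < m.+1)%N))) //= leq_addr.
(* In the combined row, the columns up to [p m] match by the choice of [z], and the later ones have
   coefficients in [J]. *)
have Ecomb : E (\sum_(l < m.+1) u m l *: (row_app l z - d l)).
  under eq_bigr => l _ do rewrite scalerBr.
  rewrite sumrB -/(d' m).
  have -> : \sum_(l < m.+1) u m l *: row_app l z = \sum_(0 <= j < B) comb m (u m) j *: z j.
    under eq_bigr => l _ do rewrite (row_appE z (NB l (leq_ord l))) scaler_sumr.
    rewrite exchange_big /=; apply: eq_bigr => j _; rewrite /comb scaler_suml.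
    by apply: eq_bigr => l _; rewrite scalerA.
  rewrite (@big_cat_nat _ _ _ (p m).+1 0 B) //=; last by rewrite leq_addl.
  rewrite addrAC; apply: (submoduleD subE).
    have [//|_ /(_ m erefl)] := zP (p m).
    by rewrite big_nat_recr //= opprB addrA [X in E (X - _) -> _]addrC.
  rewrite big_nat; apply: (submodule_sum subE) => j /andP[pj _].
  by apply: JHE => //; apply: Jp.
(* The rows below [m] hold by induction, so the combined row leaves [u m m] times the error of row
   [m]; this factor cancels. *)
apply: (injH m).
  apply: (submoduleB subH) => //; apply: (submodule_sum subH) => j _.
  exact: submoduleZ.
move: Ecomb; rewrite big_ord_recr /= => Ecomb.
rewrite -[X in E X](addKr (\sum_(l < m) u m l *: (row_app l z - d l))).
apply: (submoduleD subE) => //; apply: (submoduleN subE).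
apply: (submodule_sum subE) => l _; apply: (submoduleZ subE); apply: IHk.
by apply: leq_trans (ltn_ord l) _.
Qed.

End Triangular.
End PrimeIdeal.
End RowFinite.

(** * Sequences on which all the recurring scalars act bijectively modulo [D] *)

Section RecurrentSequences.
Variables (R : comPzRingType) (C : lmodType R) (f : nat -> R) (D : C -> Prop).
Hypothesis subD : submodule D.

Let s k := f (recur k).

(* Homomorphisms from the localization at the monoid generated by [f] to [C / D]. *)
Definition div_seq (h : nat -> C) : Prop := forall k, D (h k - s k *: h k.+1).

Lemma div_seq_submodule : submodule div_seq.
Proof.
split=> [k|a x y Hx Hy k]; first by rewrite /= scaler0 subrr; apply: submodule0 subD.
rewrite !fctE scalerDr opprD addrACA scalerA [s k * a]mulrC -scalerA -scalerBr.
exact: subD.2.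
Qed.

Lemma pointwise_submodule : submodule (fun h : nat -> C => forall k, D (h k)).
Proof.
split=> [k|a x y Hx Hy k]; first exact: submodule0 subD.
by rewrite !fctE; apply: subD.2.
Qed.

Lemma div_seq_prod h k m : div_seq h -> (k <= m)%N ->
  D (h k - (\prod_(k <= i < m) s i) *: h m).
Proof.
move=> Hh; elim: m => [|m IHm].
  by rewrite leqn0 => /eqP->; rewrite big_nil scale1r subrr; apply: submodule0 subD.
rewrite leq_eqVlt => /orP[/eqP-> | lekm].
  by rewrite big_geq // scale1r subrr; apply: submodule0 subD.
rewrite big_nat_recr //= -scalerA.
apply: (submodule_trans subD) (IHm lekm) _; rewrite -scalerBr.
by apply: submoduleZ.
Qed.

(** Modulo [D], [h k] is a multiple of [f a *: h m.+1] for any later index [m] at which [f a]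
    recurs. *)
Lemma div_seq_injective a h : div_seq h -> (forall k, D (f a *: h k)) -> forall k, D (h k).
Proof.
move=> Hh Dfh k; have [m lekm rm] := recurP a k.
rewrite -(subrK ((\prod_(k <= i < m.+1) s i) *: h m.+1) (h k)).
apply: (submoduleD subD); first by apply: div_seq_prod => //; apply: leqW.
by rewrite big_nat_recr //= -scalerA /s rm; apply: submoduleZ.
Qed.

(** To divide by [f a], write [h k] as a product of scalars applied to a later term and omit one
    factor [f a] from it. Modulo [D] the result does not depend on which occurrence is omitted. *)
Lemma div_seq_surjective a h : div_seq h ->
  exists2 h', div_seq h' & forall k, D (f a *: h' k - h k).
Proof.
move=> Hh.
have /choice[mu muP] k : exists m, (k <= m)%N /\ recur m = a.
  by have [m lekm rm] := recurP a k; exists m.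
have indep k m m' : (k <= m)%N -> (m <= m')%N -> recur m = a -> recur m' = a ->
    D ((\prod_(k <= i < m) s i) *: h m.+1 - (\prod_(k <= i < m') s i) *: h m'.+1).
  move=> lekm; rewrite leq_eqVlt => /orP[/eqP-> _ _|ltmm' rm rm'].
    by rewrite subrr; apply: submodule0 subD.
  rewrite (@big_cat_nat _ _ _ m k m') //=; last exact: ltnW.
  rewrite -scalerA -scalerBr; apply: (submoduleZ subD).
  have smm' : s m = s m' by rewrite /s rm rm'.
  rewrite big_ltn // smm' mulrC.
  have := @div_seq_prod h m.+1 m'.+1 Hh (ltnW (ltmm' : (m.+1 < m'.+1)%N)).
  by rewrite big_nat_recr.
exists (fun k => (\prod_(k <= i < mu k) s i) *: h (mu k).+1) => k.
  have [lek rk] := muP k; have [lekS rkS] := muP k.+1.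
  rewrite scalerA -big_ltn //.
  have [le|lt] := leqP (mu k) (mu k.+1); first exact: indep.
  by apply: (submodule_subC subD); apply: indep => //; apply: ltnW.
have [lek rk] := muP k; rewrite scalerA mulrC -rk -/(s _) -big_nat_recr //=.
by apply: (submodule_subC subD); apply: div_seq_prod => //; apply: leqW.
Qed.

End RecurrentSequences.

(** * Solving the system modulo ideals *)

Section Solvability.
Variables (R : comPzRingType) (T : nat -> nat -> R) (N lev : nat -> nat).
Hypothesis T_diag : forall m, T m m = 1.
Hypothesis T_upper : forall m j, m != j -> (lev j <= lev m)%N -> T m j = 0.
Hypothesis T_finite : forall m j, (N m <= j)%N -> T m j = 0.
Variable C : lmodType R.
Hypothesis C_tel : forall (f : nat -> R) (c : nat -> C),
  exists x : nat -> C, forall k, x k - f (recur k) *: x k.+1 = c k.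

Definition solvable_mod (J : R -> Prop) := forall c : nat -> C,
  exists x : nat -> C, forall m, ideal_mul J (row_app T N m x - c m).

Lemma solvable_adjoin J a : is_ideal J -> solvable_mod (adjoin J a) ->
  forall c, exists x c' : nat -> C,
    forall m, ideal_mul J (row_app T N m x + a *: c' m - c m).
Proof.
move=> idJ solJ c; have [x xP] := solJ c.
have [y yP] := choice (fun m => ideal_mul_adjoin idJ (xP m)).
by exists x, (fun m => - y m) => m; rewrite scalerN addrAC; apply: yP.
Qed.

Lemma solvable_prod J a b : is_ideal J -> J (a * b) ->
  solvable_mod (adjoin J a) -> solvable_mod (adjoin J b) -> solvable_mod J.
Proof.
move=> idJ Jab sola solb c; have sD := ideal_mul_submodule J C.
have [x [c' xP]] := solvable_adjoin idJ sola c.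
have [y [c'' yP]] := solvable_adjoin idJ solb c'.
exists (fun j => x j + a *: y j) => m; rewrite row_appD row_appZ.
have -> : row_app T N m x + a *: row_app T N m y - c m =
    row_app T N m x + a *: c' m - c m +
    (a *: (row_app T N m y + b *: c'' m - c' m) - (a * b) *: c'' m).
  rewrite scalerBr scalerDr scalerA.
  move: (row_app T N m x) (a *: row_app T N m y) (a *: c' m) (c m) => X Y q k.
  by rewrite [Y + _ - q]addrAC addrK [X + q - k]addrAC [Y - q]addrC addrA addrK addrAC.
apply: (submoduleD sD) => //; apply: (submoduleB sD); first exact: (submoduleZ sD).
exact: mem_ideal_mul.
Qed.

Lemma solvable_prime J : is_ideal J -> ~ J 1 ->
  (forall a b, J (a * b) -> J a \/ J b) ->
  (forall a, ~ J a -> solvable_mod (adjoin J a)) -> solvable_mod J.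
Proof.
move=> idJ J1 Jprime solJ c; pose D := @ideal_mul R J C.
have sD : submodule D := ideal_mul_submodule J C.
have [pu puP] := choice (pivot T_diag T_upper T_finite idJ J1).
pose p m := (pu m).1; pose u m := (pu m).2.
have {}puP m : [/\ ~ J (u m m), ~ J (comb T m (u m) (p m)),
    forall j, (p m < j)%N -> J (comb T m (u m) j) &
    forall v, (forall j, (p m <= j)%N -> J (comb T m v j)) -> J (v m)].
  by have := puP m; rewrite /p /u; case: (pu m).
have sJ := ideal_submodule idJ.
(* With a common pivot column, cross-multiplication would cancel that column while row [m] keeps a
   coefficient outside the prime [J], against the minimality of the pivot. *)
have lt_p l m : (l < m)%N -> p l <> p m.
  move=> ltlm plm; have [nJul nJpl Jl _] := puP l; have [nJum nJpm Jm minm] := puP m.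
  pose v k := comb T l (u l) (p l) * u m k -
              comb T m (u m) (p m) * (if (k <= l)%N then u l k else 0).
  have: J (v m).
    apply: minm => j; rewrite leq_eqVlt comb_lin -(comb_widen T _ _ (ltnW ltlm)).
    case/orP=> [/eqP<-|ltpj].
      by rewrite -plm mulrC subrr; apply: (submodule0 sJ).
    by apply: (submoduleB sJ); apply: (ideal_mull idJ); [apply: Jm | apply: Jl; rewrite plm].
  by rewrite /v leqNgt ltlm mulr0 subr0; apply: prime_mulNr.
have injp : injective p.
  by move=> l m plm; case: (ltngtP l m) => // /lt_p; rewrite plm; case.
(* The denominators to invert: pivot entries at even indices, leading coefficients [u m m] at odd
   ones. *)
pose f n := if odd n then u n./2 n./2 else comb T n./2 (u n./2) (p n./2).
have nJf n : ~ J (f n) by rewrite /f; case: ifP => _; case: (puP n./2).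
have f_even m : f m.*2 = comb T m (u m) (p m) by rewrite /f odd_double doubleK.
have f_odd m : f m.*2.+1 = u m m by rewrite /f /= odd_double uphalf_double.
pose s k := f (recur k).
have [F FP] : {F : nat * (nat -> C) -> (nat -> C) * (nat -> C) & forall kc m,
    D (row_app T N m (F kc).1 + s kc.1 *: (F kc).2 m - kc.2 m)}.
  apply: (@choice _ _ (fun (kc : nat * (nat -> C)) (xc : (nat -> C) * (nat -> C)) =>
    forall m, D (row_app T N m xc.1 + s kc.1 *: xc.2 m - kc.2 m))) => kc.
  have [x [c' xP]] := solvable_adjoin idJ (solJ _ (nJf (recur kc.1))) kc.2.
  by exists (x, c').
(* [cs k] is the right-hand side left after [k] approximations, and [xs k] solves for it up to a
   multiple of [s k]. *)
pose cs := nat_rect (fun=> nat -> C) c (fun k ck => (F (k, ck)).2).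
pose xs k := (F (k, cs k)).1.
have csP k m : D (row_app T N m (xs k) + s k *: cs k.+1 m - cs k m) := FP (k, cs k) m.
(* [w j 0] plays the role of the infinite sum of the terms [s 0 ... s (k - 1) *: xs k j], and
   [w j k] that of its tail. *)
have [w wP] := choice (fun j => C_tel f (fun k => xs k j)).
pose d m : nat -> C := fun k => row_app T N m (fun j => w j k) - cs k m.
have Hd m : div_seq f D (d m).
  move=> k; have := csP k m; congr D; rewrite /d -/(s k).
  have -> : row_app T N m (xs k) =
      row_app T N m (fun j => w j k) - s k *: row_app T N m (fun j => w j k.+1).
    rewrite -scaleNr -row_appZ -row_appD; apply: eq_bigr => j _.
    by rewrite -wP scaleNr.
  by rewrite scalerBr opprB [X in _ = _ + X]addrC [RHS]addrA [LHS]addrAC [X in X + _]addrAC.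
(* The triangular system is solved in the module of sequences, with [H] the divisible sequences and
   [E] those with all terms in [D]. *)
have [||m h Hh|m h Hh|z Hz zP] := @triangular_solve _ _ N T_finite J _
    (div_seq f D) (fun h => forall k, D (h k)) (div_seq_submodule f sD)
    (pointwise_submodule sD) _ p u _ injp _ _ d Hd.
- by move=> a h Ja Hh k; apply: mem_ideal_mul.
- by move=> m; case: (puP m).
- have [h' Hh' h'P] := div_seq_surjective sD m.*2 Hh; exists h' => // k.
  by rewrite -f_even; apply: h'P.
- by rewrite -f_odd; apply: div_seq_injective.
(* Only index 0 matters now, since [cs 0] is the original [c]. *)
exists (fun j => w j 0 - z j 0%N) => m.
have := zP m 0%N; rewrite !fctE /d => /(submoduleN sD); congr D.
have -> : row_app T N m z 0%N = row_app T N m (fun j => z j 0%N).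
  by rewrite /row_app fct_sumE.
rewrite opprB addrAC; congr (_ - _).
by rewrite /row_app -sumrB; apply: eq_bigr => j _; rewrite scalerBr.
Qed.

Lemma row_finite_solvable : noetherian R ->
  forall c : nat -> C, exists x : nat -> C, forall m, row_app T N m x = c m.
Proof.
move=> noeth c.
have sol J : is_ideal J -> solvable_mod J.
  apply: (noetherian_ind noeth) => {}J idJ IH.
  have solJ a : ~ J a -> solvable_mod (adjoin J a).
    move=> nJa; apply: IH; first exact: adjoin_ideal.
      exact: sub_adjoin.
    by exists a; split=> //; apply: adjoin_gen.
  have [J1|nJ1] := pselect (J 1).
    move=> c'; exists (fun=> 0) => m; rewrite -[X in ideal_mul _ X]scale1r.
    exact: mem_ideal_mul.
  have [[a [b [nJa nJb Jab]]]|Jprime] :=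
      pselect (exists a b, [/\ ~ J a, ~ J b & J (a * b)]).
    exact: solvable_prod idJ Jab (solJ a nJa) (solJ b nJb).
  apply: solvable_prime => // a b Jab; apply: contrapT => nJ; apply: Jprime.
  by exists a, b; split=> // J'; apply: nJ; [left | right].
(* Solving modulo the zero ideal is solving exactly, as the zero submodule contains all its
   multiples. *)
have [|x xP] := sol (fun a => a = 0) _ c.
  by split=> //; split=> [x y -> -> | r x ->]; rewrite ?addr0 ?mulr0.
exists x => m; apply/eqP; rewrite -subr_eq0; apply/eqP.
apply: (xP m (fun y => y = 0)) => [|_ y ->]; last by rewrite scale0r.
by split=> // a y z -> ->; rewrite scaler0 addr0.
Qed.

End Solvability.

(** * Countably generated flat modules *)

Lemma submoduleT (R : comPzRingType) (V : lmodType R) : submodule (fun _ : V => True).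
Proof. by []. Qed.

(** * The equational criterion for flatness *)

Section EquationalCriterion.
Variables (R : comPzRingType) (F : lmodType R).

Section Relation.
Variables (n : nat) (r : nat -> R).

Lemma syzygy_submodule :
  submodule (fun a : nat -> R^o => \sum_(p < n) r p * (a p : R) = 0).
Proof.
split=> [|b x y x0 y0]; first by rewrite big1 // => p _; apply: mulr0.
under eq_bigr => p _ do rewrite !fctE mulrDr [r p * _]mulrCA.
by rewrite big_split /= -mulr_sumr x0 y0 mulr0 addr0.
Qed.

(** The image of the tensor product of the syzygy module of [r] with [F] in the module of sequences
    in [F]. *)
Definition syzygy_span (v : nat -> F) : Prop :=
  exists m (A : nat -> nat -> R) (y : nat -> F),
    (forall q, (q < m)%N -> \sum_(p < n) r p * A p q = 0) /\
    forall p, v p = \sum_(q < m) A p q *: y q.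

Lemma syzygy_span_submodule : submodule syzygy_span.
Proof.
split; first by exists 0%N, (fun _ _ => 0), (fun=> 0); split=> // p; rewrite big_ord0.
move=> b v w [m [A [y [A0 vE]]]] [m' [A' [y' [A'0 wE]]]].
exists (m + m')%N, (fun p q => if (q < m)%N then b * A p q else A' p (q - m)%N),
  (fun q => if (q < m)%N then y q else y' (q - m)%N).
split=> [q ltq|p]; last first.
  rewrite !fctE vE wE big_split_ord scaler_sumr; congr (_ + _); apply: eq_bigr => q _ /=.
    by rewrite ltn_ord scalerA.
  by rewrite ltnNge leq_addr /= addKn.
case: ltnP => [ltqm|lemq].
  by under eq_bigr => p _ do rewrite mulrCA; rewrite -mulr_sumr A0 ?mulr0.
by apply: A'0; rewrite ltn_subLR.
Qed.

Let full (V : lmodType R) := Submod (@submoduleT R V).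
Let M := subquot (full (nat -> R^o)) (Submod syzygy_submodule).
Let P := subquot (full (nat -> F)) (Submod syzygy_span_submodule).
Let clM : (nat -> R^o) -> M := sq_class _ _.
Let clP : (nat -> F) -> P := sq_class _ _.

(** Sequences modulo syzygies embed into [R] by pairing with [r]. The sum of the tensors of basis
    vectors with the [y p] maps to 0 there, so flatness makes it 0; the bilinear map [b] then puts
    [y], cut off at [n], into [syzygy_span]. *)
Lemma flat_relation (y : nat -> F) : flat F -> \sum_(p < n) r p *: y p = 0 ->
  exists m (A : nat -> nat -> R) (y' : nat -> F),
    (forall p, (p < n)%N -> y p = \sum_(q < m) A p q *: y' q) /\
    forall q, (q < m)%N -> \sum_(p < n) r p * A p q = 0.
Proof.
move=> flatF ry0.
pose f (q : M) : R^o := \sum_(p < n) r p * (sq_repr q p : R).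
have fE a : f (clM a) = \sum_(p < n) r p * (a p : R).
  have /= := @sq_class_repr _ _ (full _) (Submod syzygy_submodule) a I.
  under eq_bigr => p _ do rewrite !fctE mulrBr.
  by rewrite sumrB => /eqP; rewrite subr_eq0 => /eqP.
have linf : is_linear f.
  move=> b; elim/sq_ind=> u _; elim/sq_ind=> v _.
  rewrite -sq_class_linear // !fE scaler_sumr -big_split; apply: eq_bigr => p _ /=.
  by rewrite !fctE mulrDr [r p * _]mulrCA.
have injf : injective f.
  move=> q q' fqq'; apply/eqP; rewrite -subr_eq0; apply/eqP.
  have: f (q - q') = 0 by rewrite (is_linearB linf) fqq' subrr.
  by elim/sq_ind: (q - q') => u _; rewrite fE => u0; apply/sq_class0.
pose b (q : M) (z : F) : P := clP (fun p => (sq_repr q p : R) *: z).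
have bE u z : b (clM u) z = clP (fun p => (u p : R) *: z).
  apply/sq_classP => //=; exists 1%N.
  exists (fun p _ => (sq_repr (clM u) p : R) - u p), (fun=> z); split=> [_ _|p]; last first.
    by rewrite big_ord1 !fctE scalerBl.
  apply: (submodule_subC syzygy_submodule (x := u)).
  exact: (@sq_class_repr _ _ (full _) (Submod syzygy_submodule) u I).
have bilb : is_bilinear b.
  split=> [a|a]; elim/sq_ind=> u _.
    elim/sq_ind=> v _ z; rewrite -sq_class_linear // !bE -sq_class_linear //.
    by congr sq_class; apply/funext => p; rewrite !fctE scalerDl scalerA.
  move=> z w; rewrite !bE -sq_class_linear //.
  by congr sq_class; apply/funext => p; rewrite !fctE scalerDr !scalerA mulrC.
pose dl (p : nat) : nat -> R^o := fun p' => (p' == p)%:R.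
have dlE (p : 'I_n) : \sum_(p' < n) r p' * (dl p p' : R) = r p.
  rewrite (bigD1 p) //= big1 ?addr0 => [|p' np]; rewrite /dl ?eqxx ?mulr1 //.
  by rewrite (inj_eq val_inj) (negPf np) mulr0.
pose xs := [seq (clM (dl p), y p) | p <- index_iota 0 n].
have xs0 : tensor_zero [seq (f x.1, x.2) | x <- xs].
  move=> Q b0 [b0l b0r]; rewrite big_map big_map big_mkord /=.
  have b0s (a : R) z : b0 (a : R^o) z = b0 (1 : R^o) (a *: z).
    have b0z : b0 (0 : R^o) z = 0.
      apply: (addrI (b0 (0 : R^o) z)); rewrite addr0.
      by have := b0l 1 0 0 z; rewrite scaler0 addr0 scale1r => <-.
    have := b0l a 1 0 z; rewrite addr0 b0z addr0 [a *: _]mulr1 => ->.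
    by rewrite (is_linearZ (f := b0 (1 : R^o))) // => c; apply: b0r.
  under eq_bigr => p _ do rewrite fE dlE b0s.
  rewrite -(is_linear_sum (f := b0 (1 : R^o))) ?ry0; last by move=> c; apply: b0r.
  by rewrite (is_linear0 (f := b0 (1 : R^o))) // => c; apply: b0r.
have := flatF M R^o f linf injf xs xs0 P b bilb; rewrite big_map big_mkord /=.
under eq_bigr => p _ do rewrite bE.
rewrite -(is_linear_sum (f := clP)); last by move=> c u v; apply: sq_class_linear.
move=> /sq_class0 [//|m [A [y' [A0 yE]]]].
exists m, A, y'; split=> // p ltpn; rewrite -yE fct_sumE.
rewrite (bigD1 (Ordinal ltpn)) //= big1 ?addr0 => [|p' np]; rewrite /dl ?eqxx ?scale1r //.
have -> : (p == p') = false by apply/negP => /eqP pp'; case/eqP: np; apply: val_inj.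
by rewrite scale0r.
Qed.

End Relation.

Lemma sum_subst (V : lmodType R) n m (r : nat -> R) (A : nat -> nat -> R) (y y' : nat -> V) :
  (forall p, (p < n)%N -> y p = \sum_(q < m) A p q *: y' q) ->
  \sum_(p < n) r p *: y p = \sum_(q < m) (\sum_(p < n) r p * A p q) *: y' q.
Proof.
move=> yE; under eq_bigr => p _ do rewrite yE // scaler_sumr.
rewrite exchange_big; apply: eq_bigr => q _; rewrite scaler_suml.
by apply: eq_bigr => p _; rewrite scalerA.
Qed.

(** The relations are killed one at a time: the next one is rewritten in the new family, and
    composing the matrices preserves the relations already killed. *)
Lemma flat_relations n k (rho : nat -> nat -> R) (y : nat -> F) : flat F ->
  (forall i, (i < k)%N -> \sum_(p < n) rho i p *: y p = 0) ->
  exists m (A : nat -> nat -> R) (y' : nat -> F),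
    (forall p, (p < n)%N -> y p = \sum_(q < m) A p q *: y' q) /\
    forall i q, (i < k)%N -> (q < m)%N -> \sum_(p < n) rho i p * A p q = 0.
Proof.
move=> flatF; elim: k => [|k IHk] rho0.
  exists n, (fun p q => (p == q)%:R), y; split=> // p ltpn.
  rewrite (bigD1 (Ordinal ltpn)) //= big1 ?addr0 => [|q nq]; rewrite ?eqxx ?scale1r //.
  have -> : (p == q) = false by apply/negP => /eqP pq; case/eqP: nq; apply: val_inj.
  by rewrite scale0r.
have [|m [A [y' [yE A0]]]] := IHk; first by move=> i ltik; apply: rho0; apply: leqW.
have := rho0 k (leqnn _); rewrite (sum_subst _ yE).
move=> /(flat_relation (r := fun q => \sum_(p < n) rho k p * A p q) flatF).
move=> [m' [B [y'' [y'E B0]]]].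
exists m', (fun p q => \sum_(q' < m) A p q' * B q' q), y''; split=> [p ltpn|i q leik ltqm].
  by rewrite yE // (sum_subst _ y'E).
have -> : \sum_(p < n) rho i p * (\sum_(q' < m) A p q' * B q' q) =
          \sum_(q' < m) (\sum_(p < n) rho i p * A p q') * B q' q.
  under eq_bigr => p _ do rewrite mulr_sumr.
  rewrite exchange_big; apply: eq_bigr => q' _; rewrite mulr_suml.
  by apply: eq_bigr => p _; rewrite mulrA.
move: leik; rewrite ltnS leq_eqVlt => /orP[/eqP-> | ltik]; first exact: B0.
by rewrite big1 // => q' _; rewrite A0 ?mul0r.
Qed.

(** Finite generation in [R^n], with vectors stored as sequences read below [n], and generation
    tested on predicates [D] blind to later entries. Induction on [n]: the last coordinates form an
    ideal, and the vectors where that coordinate vanishes fall under the induction hypothesis. *)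
Lemma noetherian_submodule_fg n (U : (nat -> R^o) -> Prop) : noetherian R -> submodule U ->
  exists k (rho : nat -> nat -> R^o), (forall i, (i < k)%N -> U (rho i)) /\
    forall D : (nat -> R^o) -> Prop, submodule D ->
      (forall u v, (forall p, (p < n)%N -> u p = v p) -> D u -> D v) ->
      (forall i, (i < k)%N -> D (rho i)) -> forall u, U u -> D u.
Proof.
move=> noeth; elim: n U => [|n IHn] U subU.
  exists 0%N, (fun=> 0); split=> // D subD Dext _ u _.
  by apply: (Dext 0) => //; apply: submodule0 subD.
have [|k [rho [rhoU rhoP]]] := IHn (fun u => U u /\ u n = 0).
  split=> [|a u v [Uu u0] [Uv v0]]; first by split=> //; apply: submodule0 subU.
  by split; [apply: subU.2 | rewrite !fctE u0 v0 scaler0 addr0].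
have [|l [g [gU gP]]] := noeth (fun a => exists2 u, U u & u n = a).
  split; first by exists 0 => //; apply: submodule0 subU.
  split=> [_ _ [u Uu <-] [v Uv <-] | a _ [u Uu <-]].
    by exists (u + v) => //; apply: submoduleD.
  by exists (a *: u) => //; apply: submoduleZ.
have [sg sgP] : {sg : nat -> nat -> R^o & forall i, (i < l)%N -> U (sg i) /\ sg i n = g i}.
  apply: (@choice _ _ (fun i v => (i < l)%N -> U v /\ v n = g i)) => i.
  have [ltil|leli] := ltnP i l; last by exists 0.
  by have [u Uu un] := gU i ltil; exists u.
exists (k + l)%N, (fun i => if (i < k)%N then rho i else sg (i - k)%N); split.
  move=> i lti; case: ltnP => [ltik|leki]; first by case: (rhoU i ltik).
  by apply: (sgP _ _).1; rewrite ltn_subLR.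
move=> D subD Dext Dgen u Uu.
have Drho i : (i < k)%N -> D (rho i).
  by move=> ltik; have := Dgen i; rewrite ltik; apply; apply: ltn_addr.
have Dsg i : (i < l)%N -> D (sg i).
  move=> ltil; have := Dgen (k + i)%N; rewrite ltn_add2l => /(_ ltil).
  by rewrite ltnNge leq_addr /= addKn.
have [|c unE] := gP (u n); first by exists u.
pose v := \sum_(i < l) c i *: sg i.
have Uv : U v by apply: (submodule_sum subU) => i _; apply: (submoduleZ subU); case: (sgP i).
have Dv : D v by apply: (submodule_sum subD) => i _; apply: (submoduleZ subD); apply: Dsg.
have vn : v n = u n.
  by rewrite unE /v fct_sumE; apply: eq_bigr => i _; rewrite !fctE; case: (sgP i) => // _ ->.
rewrite -(subrK v u); apply: (submoduleD subD) => //.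
pose cut (w : nat -> R^o) : nat -> R^o := fun p => if (p < n)%N then w p else 0.
have cutP w : w n = 0 -> forall p, (p < n.+1)%N -> cut w p = w p.
  by move=> wn p; rewrite ltnS leq_eqVlt /cut => /orP[/eqP->|->]; rewrite ?ltnn.
have uvn : (u - v) n = 0 by rewrite !fctE vn subrr.
apply: (Dext (cut (u - v))); first exact: cutP.
(* Truncation makes the test predicate ignore coordinate [n], as the induction hypothesis
   demands. *)
apply: (rhoP (fun w => D (cut w))) => //.
- split=> [|a w w' Dw Dw'].
    rewrite (_ : cut 0 = 0); first exact: submodule0 subD.
    by apply/funext => p; rewrite /cut; case: ifP.
  rewrite (_ : cut _ = a *: cut w + cut w'); first exact: subD.2.
  by apply/funext => p; rewrite /cut !fctE; case: ifP => // _; rewrite scaler0 addr0.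
- move=> w w' ww'; congr D; apply/funext => p; rewrite /cut.
  by case: ifP => // /ww'.
- move=> i ltik; apply: (Dext (rho i)); last exact: Drho.
  by move=> p ltpn; rewrite cutP //; case: (rhoU i ltik).
- by split=> //; apply: submoduleB.
Qed.

(** The module of relations is finitely generated, and killing its generators kills them all. *)
Lemma kill_relations n (y : nat -> F) : noetherian R -> flat F ->
  exists m (A : nat -> nat -> R) (y' : nat -> F),
    (forall p, (p < n)%N -> y p = \sum_(q < m) A p q *: y' q) /\
    forall r : nat -> R, \sum_(p < n) r p *: y p = 0 ->
      forall q, (q < m)%N -> \sum_(p < n) r p * A p q = 0.
Proof.
move=> noeth flatF; pose U (r : nat -> R^o) := \sum_(p < n) (r p : R) *: y p = 0.
have subU : submodule U.
  split=> [|a u v u0 v0]; first by apply: big1 => p _; apply: scale0r.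
  rewrite /U; under eq_bigr => p _ do rewrite !fctE scalerDl -scalerA.
  by rewrite big_split /= -scaler_sumr u0 v0 scaler0 addr0.
have [k [rho [rhoU rhoP]]] := noetherian_submodule_fg n noeth subU.
have [m [A [y' [yE A0]]]] := flat_relations flatF rhoU.
exists m, A, y'; split=> // r ry0 q ltqm.
apply: (rhoP (fun u => \sum_(p < n) (u p : R) * A p q = 0)) => //.
- split=> [|a u v u0 v0]; first by rewrite big1 // => p _; apply: mul0r.
  under eq_bigr => p _ do rewrite !fctE mulrDl -mulrA.
  by rewrite big_split /= -mulr_sumr u0 v0 mulr0 addr0.
- by move=> u v uv u0; rewrite -[RHS]u0; apply: eq_bigr => p _; rewrite uv.
- by move=> i ltik; apply: A0.
Qed.

End EquationalCriterion.

Section Presentation.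
Variables (R : comPzRingType) (F : lmodType R).

(* [F] is the colimit of the free modules [R^(n i)] along the matrices [A i]
   ([y i] is the image of the standard basis of [R^(n i)]). *)
Lemma flat_sequential_colimit : noetherian R -> countably_generated F -> flat F ->
  exists (n : nat -> nat) (y : nat -> nat -> F) (A : nat -> nat -> nat -> R),
  [/\ forall i p, (p < n i)%N -> y i p = \sum_(q < n i.+1) A i p q *: y i.+1 q,
      forall i (r : nat -> R), \sum_(p < n i) r p *: y i p = 0 ->
        forall q, (q < n i.+1)%N -> \sum_(p < n i) r p * A i p q = 0 &
      forall x, exists i (r : nat -> R), x = \sum_(p < n i) r p *: y i p].
Proof.
move=> noeth [g gP] flatF.
pose stage := (nat * (nat -> F))%type.
pose next (iz : nat * stage) (Bz : (nat -> nat -> R) * stage) :=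
  let: (i, (n, y)) := iz in let: (B, (m, z)) := Bz in
  [/\ forall p, (p < n)%N -> y p = \sum_(q < m) B p q *: z q,
      forall r : nat -> R, \sum_(p < n) r p *: y p = 0 ->
        forall q, (q < m)%N -> \sum_(p < n) r p * B p q = 0 &
      exists2 q, (q < m)%N & z q = g i].
have /choice[S SP] : forall iz, exists Bz, next iz Bz.
  move=> [i [n y]]; have [m [B [z [yE B0]]]] := kill_relations n y noeth flatF.
  (* The generator [g i] is appended to the new family with a zero column, so that the stages
     exhaust [F]. *)
  exists (fun p q => if (q < m)%N then B p q else 0,
          (m.+1, fun q => if (q < m)%N then z q else g i)); split.
  - move=> p ltpn; rewrite big_ord_recr /= ltnn scale0r addr0 yE //.
    by apply: eq_bigr => q _; rewrite ltn_ord.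
  - move=> r /B0 rB q _ /=; case: (ltnP q m) => [/rB //|_].
    by rewrite big1 // => p _; rewrite mulr0.
  - by exists m; rewrite ?ltnn.
pose st := nat_rect (fun=> stage) (0%N, fun=> 0) (fun i z => (S (i, z)).2).
pose n i := (st i).1; pose y i := (st i).2; pose A i := (S (i, st i)).1.
have stP i : [/\ forall p, (p < n i)%N -> y i p = \sum_(q < n i.+1) A i p q *: y i.+1 q,
      forall r : nat -> R, \sum_(p < n i) r p *: y i p = 0 ->
        forall q, (q < n i.+1)%N -> \sum_(p < n i) r p * A i p q = 0 &
      exists2 q, (q < n i.+1)%N & y i.+1 q = g i].
  have := SP (i, st i); rewrite /n /y /A /=.
  by case: (st i) => ni yi; case: (S _) => B [m z].
exists n, y, A; split=> [i|i|x]; try by case: (stP i).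
have [k [c ->]] := gP x; exists k; elim: k => [|k [r rE]].
  by exists (fun=> 0); rewrite !big_ord0.
have [yE _ [q ltq yq]] := stP k.
exists (fun q' => \sum_(p < n k) r p * A k p q' + c k * (q' == q)%:R).
rewrite big_ord_recr /= rE (sum_subst _ yE).
under [RHS]eq_bigr => q' _ do rewrite scalerDl.
rewrite big_split /=; congr (_ + _).
rewrite (bigD1 (Ordinal ltq)) //= eqxx mulr1 yq big1 ?addr0 // => q' nq.
have -> : (q' == q :> nat) = false by apply/negP => /eqP qq; case/eqP: nq; apply: val_inj.
by rewrite mulr0 scale0r.
Qed.

End Presentation.

(** * Splitting extensions of a sequential colimit *)

Section Splitting.
Variables (R : comPzRingType) (n : nat -> nat) (A : nat -> nat -> nat -> R).

Let idx := Cantor.to_nat.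
Let lev m := (Cantor.of_nat m).1.
Let pos m := (Cantor.of_nat m).2.

(** The matrix of [x_i - A_i x_(i+1)], with the pairs (stage, position) coded as single indices; the
    level of an index is its stage. *)
Definition colim_matrix m j : R :=
  (j == m)%:R - \sum_(q < n (lev m).+1) (j == idx ((lev m).+1, val q))%:R * A (lev m) (pos m) q.

Definition colim_bound m : nat := (m.+1 + \sum_(q < n (lev m).+1) (idx ((lev m).+1, val q)).+1)%N.

Lemma idx_colim_bound m q : (q < n (lev m).+1)%N -> (idx ((lev m).+1, q) < colim_bound m)%N.
Proof.
move=> ltq; apply: leq_trans (leq_addl _ _).
by rewrite (bigD1 (Ordinal ltq)) //= leq_addr.
Qed.

Lemma lev_idx i q : lev (idx (i, q)) = i.
Proof. by rewrite /lev /idx Cantor.cancel_of_to. Qed.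

Lemma colim_matrix_diag m : colim_matrix m m = 1.
Proof.
rewrite /colim_matrix eqxx big1 ?subr0 // => q _.
case: eqP => [mE|_]; rewrite ?mul0r //.
by have := lev_idx (lev m).+1 q; rewrite -mE => /n_Sn.
Qed.

Lemma colim_matrix_upper m j : m != j -> (lev j <= lev m)%N -> colim_matrix m j = 0.
Proof.
rewrite eq_sym /colim_matrix => /negPf-> le; rewrite big1 ?subr0 // => q _.
case: eqP => [jE|_]; rewrite ?mul0r //.
by move: le; rewrite jE lev_idx ltnn.
Qed.

Lemma colim_matrix_finite m j : (colim_bound m <= j)%N -> colim_matrix m j = 0.
Proof.
move=> le; rewrite /colim_matrix gtn_eqF ?sub0r; last first.
  by apply: leq_trans le; apply: leq_addr.
rewrite big1 ?oppr0 // => q _; rewrite gtn_eqF ?mul0r //.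
by apply: leq_trans le; apply: idx_colim_bound (ltn_ord q).
Qed.

Lemma sum_indicator (V : lmodType R) B a (x : nat -> V) : (a < B)%N ->
  \sum_(0 <= j < B) (j == a)%:R *: x j = x a.
Proof.
move=> ltaB; rewrite big_mkord (bigD1 (Ordinal ltaB)) //= eqxx scale1r.
rewrite big1 ?addr0 // => j nj.
have -> : (j == a :> nat) = false by apply/negP => /eqP ja; case/eqP: nj; apply: val_inj.
by rewrite scale0r.
Qed.

Lemma colim_row_app (V : lmodType R) i p (x : nat -> V) :
  row_app colim_matrix colim_bound (idx (i, p)) x =
  x (idx (i, p)) - \sum_(q < n i.+1) A i p q *: x (idx (i.+1, val q)).
Proof.
have posE : pos (idx (i, p)) = p by rewrite /pos /idx Cantor.cancel_of_to.
rewrite /row_app /colim_matrix; under eq_bigr => j _ do rewrite scalerBl.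
rewrite sumrB sum_indicator; last by rewrite leq_addr.
congr (_ - _); under eq_bigr => j _ do rewrite scaler_suml.
rewrite exchange_big /= lev_idx posE; apply: eq_bigr => q _.
under eq_bigr => j _ do rewrite mulrC -scalerA.
rewrite -scaler_sumr sum_indicator //.
have := @idx_colim_bound (idx (i, p)) q; rewrite lev_idx; apply; exact: ltn_ord.
Qed.

Variables (F : lmodType R) (y : nat -> nat -> F).
Hypothesis yE : forall i p, (p < n i)%N -> y i p = \sum_(q < n i.+1) A i p q *: y i.+1 q.
Hypothesis y_rel : forall i (r : nat -> R), \sum_(p < n i) r p *: y i p = 0 ->
  forall q, (q < n i.+1)%N -> \sum_(p < n i) r p * A i p q = 0.
Hypothesis y_gen : forall x, exists i (r : nat -> R), x = \sum_(p < n i) r p *: y i p.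

(** The section sends a combination of the [y i] to the same combination of the [z i]. It is well
    defined because the coefficients of a relation vanish one stage later. *)
Lemma colim_map_lift (E : lmodType R) (z : nat -> nat -> E) (p : E -> F) :
  is_linear p -> (forall i q, (q < n i)%N -> p (z i q) = y i q) ->
  (forall i q, (q < n i)%N -> z i q = \sum_(q' < n i.+1) A i q q' *: z i.+1 q') ->
  exists s : F -> E, is_linear s /\ forall m, p (s m) = m.
Proof.
move=> linp pz zE.
pose at_stage i x e := exists r : nat -> R,
  x = \sum_(q < n i) r q *: y i q /\ e = \sum_(q < n i) r q *: z i q.
have at_stageW i j x e : (i <= j)%N -> at_stage i x e -> at_stage j x e.
  move=> /subnKC<- xe; elim: (j - i)%N => [|d [r [-> ->]]]; first by rewrite addn0.
  rewrite addnS; exists (fun q => \sum_(q' < n (i + d)%N) r q' * A (i + d)%N q' q).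
  by split; apply: sum_subst => q ltq; [apply: yE | apply: zE].
pose Sec x e := exists i, at_stage i x e.
have Sec_lin a x e x' e' : Sec x e -> Sec x' e' -> Sec (a *: x + x') (a *: e + e').
  move=> [i xe] [i' xe']; exists (maxn i i').
  have [r [-> ->]] := at_stageW _ _ _ _ (leq_maxl i i') xe.
  have [r' [-> ->]] := at_stageW _ _ _ _ (leq_maxr i i') xe'.
  exists (fun q => a * r q + r' q).
  by split; rewrite scaler_sumr -big_split; apply: eq_bigr => q _ /=;
     rewrite scalerDl scalerA.
have Sec0 e : Sec 0 e -> e = 0.
  move=> [i [r [/esym r0 ->]]]; rewrite (sum_subst _ (zE i)) big1 // => q _.
  by rewrite (y_rel r0) ?scale0r.
have Sec_fun x e e' : Sec x e -> Sec x e' -> e = e'.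
  move=> xe xe'; have := Sec_lin (-1) _ _ _ _ xe' xe.
  by rewrite !scaleN1r addNr addrC => /Sec0/eqP; rewrite subr_eq0 => /eqP.
have /choice[s sP] x : exists e, Sec x e.
  by have [i [r xE]] := y_gen x; exists (\sum_(q < n i) r q *: z i q), i, r.
exists s; split=> [a x x'|x].
  exact: Sec_fun (sP _) (Sec_lin a _ _ _ _ (sP x) (sP x')).
have [i [r [xE ->]]] := sP x; rewrite [RHS]xE (is_linear_sum linp).
by apply: eq_bigr => q _; rewrite (is_linearZ linp) pz.
Qed.

(** Arbitrary lifts [w] of the [y i] fail to be compatible by elements [c] of [C]; a solution [x] of
    the system corrects them. Positions outside the families impose nothing on [c]. *)
Lemma colim_ext1_zero (C : lmodType R) :
  (forall c : nat -> C, exists x : nat -> C,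
     forall m, row_app colim_matrix colim_bound m x = c m) ->
  ext1_zero F C.
Proof.
move=> sol E j p linj linp injj surjp exactp.
have pj c : p (j c) = 0 by apply/exactp; exists c.
have [e pe] := choice surjp.
pose w i q := e (y i q).
have /choice[c cP] m : exists c, (pos m < n (lev m))%N ->
    j c = w (lev m) (pos m) - \sum_(q < n (lev m).+1) A (lev m) (pos m) q *: w (lev m).+1 q.
  case: (ltnP (pos m) _) => [ltp|_]; last by exists 0.
  suff /exactp[c jc] : p (w (lev m) (pos m) -
      \sum_(q < n (lev m).+1) A (lev m) (pos m) q *: w (lev m).+1 q) = 0 by exists c.
  rewrite (is_linearB linp) (is_linear_sum linp) /w pe yE //.
  apply/eqP; rewrite subr_eq0; apply/eqP/eq_bigr => q _.
  by rewrite (is_linearZ linp) pe.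
have [x xP] := sol c.
apply: (@colim_map_lift E (fun i q => w i q - j (x (idx (i, q)))) p) => // i q ltq.
  by rewrite (is_linearB linp) pj subr0 /w pe.
have posE : pos (idx (i, q)) = q by rewrite /pos /idx Cantor.cancel_of_to.
have := cP (idx (i, q)); rewrite -xP colim_row_app posE lev_idx => /(_ ltq).
rewrite (is_linearB linj) (is_linear_sum linj) => jE.
under eq_bigr => q' _ do rewrite scalerBr -(is_linearZ linj).
rewrite sumrB; move/eqP: jE; rewrite subr_eq => /eqP->.
by rewrite opprD opprB addrA subrKC.
Qed.

End Splitting.

Theorem theorem2p4 (R : comPzRingType) (F : lmodType R) :
  noetherian R -> countably_generated F -> flat F -> quite_flat F.
Proof.
move=> noeth cgF flatF C acC.
have [n [y [A [yE y_rel y_gen]]]] := flat_sequential_colimit noeth cgF flatF.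
apply: (colim_ext1_zero yE y_rel y_gen).
apply: (row_finite_solvable (@colim_matrix_diag _ n A) (@colim_matrix_upper _ n A)
         (@colim_matrix_finite _ n A)) noeth => f c.
exact: telescope_solvable.
Qed.
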